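(* Let $h\ge 1$ be an integer, $r>0$, $0<p<1$, and let $v\neq0$ and $b$ be real constants. Let $g(x)=\sum_{n=0}^\infty \beta_n x^n$ with $\beta_n\sim v\,\frac{\exp(r n^p)}{n^b}$, and let $g(x)^h=\sum_{n=0}^\infty a_n x^n$. Then $$a_n\sim v^h\,h^{\,bh+\frac{hp}{2}-h-\frac p2+\frac12}\left(\frac{2\pi}{(1-p)pr}\right)^{\frac{h-1}{2}}\frac{\exp\!\left(r\,h^{1-p}n^p\right)}{n^{\,bh-\frac12(h-1)(2-p)}}\qquad(n\to\infty).$$
   Context: For sequences $x_n,y_n$, $x_n\sim y_n$ means $x_n/y_n\to 1$ as $n\to\infty$. *)

(* Defs.v *)
From HB Require Import structures.
From mathcomp Require Import all_boot all_order all_algebra.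
From mathcomp Require Import all_classical all_reals all_analysis.
Set Implicit Arguments.
Unset Strict Implicit.
Unset Printing Implicit Defensive.
Import Order.TTheory GRing.Theory Num.Theory.
Import numFieldNormedType.Exports.
Local Open Scope classical_set_scope.
Local Open Scope ring_scope.

(* Finitely many indices with [y n = 0] (e.g. n = 0, where [0 `^ b = 0] for
   b != 0, so that dividing by it gives 0) do not affect this. *)
Definition asymp_equiv (R : realType) (x y : R^nat) : Prop :=
  (fun n => x n / y n) @ \oo --> (1 : R).

(* A power series [\sum_n u_n x^n] is represented by its sequence of
   coefficients; multiplication is the Cauchy product. *)
Definition series_one (R : realType) : R^nat := fun n => (n == 0%N)%:R.

Definition series_mul (R : realType) (u w : R^nat) : R^nat :=
  fun n => \sum_(k < n.+1) u k * w (n - k)%N.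

Definition series_exp (R : realType) (u : R^nat) (h : nat) : R^nat :=
  iter h (series_mul u) (@series_one R).

(* Main.v *)
(* Induction on h. Put N = n / (h + 1). The n-th coefficient of g * g^h is a
   sum over k of beta_k a_(n-k) whose exponent r (k^p + h ((n - k) / h)^p) is
   maximal at k = N and, by a second-order expansion of x^p, decreases like a
   Gaussian in s = (k - N) / N^(1 - p/2). Rescaled to the variable s, the sum
   is the integral of a step function, and dominated convergence turns it into
   a Gaussian integral. Strict concavity of x^p makes half of the Gaussian decay
   available as dominating function, the other half absorbs the powers of n. *)
Require Import Defs.
From HB Require Import structures.
From mathcomp Require Import all_boot all_order all_algebra.
From mathcomp Require Import all_classical all_reals all_analysis.
From mathcomp Require Import measurable_realfun ring lra.
Set Implicit Arguments.
Unset Strict Implicit.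
Unset Printing Implicit Defensive.
Import Order.TTheory GRing.Theory Num.Theory.
Import numFieldNormedType.Exports.
Local Open Scope classical_set_scope.
Local Open Scope ring_scope.

(** * Quadratic bounds for [x^p] around 1 *)

Lemma cvg_powR (R : realType) (u : R^nat) (a l : R) : 0 < l ->
  u @ \oo --> l -> (fun n => u n `^ a) @ \oo --> l `^ a.
Proof.
move=> l0 ul; have [d _] := @is_derive1_powR R a l l0.
have c : {for l, continuous (fun x : R => x `^ a)}.
  exact/differentiable_continuous/derivable1_diffP.
exact: (@continuous_cvg _ _ _ _ _ _ (fun x : R => x `^ a) l c ul).
Qed.

(** Two uses of the mean value theorem: [f2 >= 0] makes [f1] nondecreasing, so the mean slope of [f]
    between [x0] and [z] lies on the right side of [f1 x0]. *)
Lemma tangent_le (R : realType) (f f1 f2 : R -> R) (I : interval R) (x0 z : R) :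
  {in I, forall x, is_derive (x : R) 1 f (f1 x)} ->
  {in I, forall x, is_derive (x : R) 1 f1 (f2 x)} ->
  {in I, forall x : R, 0 <= f2 x} ->
  x0 \in I -> z \in I -> f x0 + f1 x0 * (z - x0) <= f z.
Proof.
move=> df df1 f2_ge0 Ix0 Iz.
have sub x y w : x \in I -> y \in I -> w \in `[x, y]%R -> w \in I.
  move=> Ix Iy; rewrite in_itv/= => /andP[xw wy].
  by apply: (@interval_is_interval _ I x y) => //; rewrite xw wy.
have mvt (g dg : R -> R) (x y : R) :
    {in I, forall x, is_derive (x : R) 1 g (dg x)} ->
    x \in I -> y \in I -> x < y ->
    exists2 c, c \in `]x, y[%R & g y - g x = dg c * (y - x).
  move=> gdg Ix Iy xy; apply: MVT => // [w wxy|].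
    by apply: gdg; apply: sub Ix Iy _; apply: subset_itv_oo_cc.
  apply: derivable_within_continuous => w wxy.
  by have [] := gdg w (sub _ _ _ Ix Iy wxy).
have f1_le x y : x \in I -> y \in I -> x < y -> f1 x <= f1 y.
  move=> Ix Iy xy; have [c cxy e] := mvt _ _ _ _ df1 Ix Iy xy.
  rewrite -subr_ge0 e mulr_ge0 ?subr_ge0 ?(ltW xy)//; apply: f2_ge0.
  by apply: sub Ix Iy _; apply: subset_itv_oo_cc.
have [xz|zx|->] := ltgtP x0 z; last by rewrite subrr mulr0 addr0.
  have [c cxz e] := mvt _ _ _ _ df Ix0 Iz xz.
  rewrite -lerBrDl e ler_pM2r ?subr_gt0//; apply: f1_le => //.
    by apply: sub Ix0 Iz _; apply: subset_itv_oo_cc.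
  by move: cxz; rewrite in_itv/= => /andP[].
have [c cxz e] := mvt _ _ _ _ df Iz Ix0 zx.
rewrite -lerBrDl -opprB -[leRHS]opprB mulrN lerN2 e ler_pM2r ?subr_gt0//.
apply: f1_le => //.
  by apply: sub Iz Ix0 _; apply: subset_itv_oo_cc.
by move: cxz; rewrite in_itv/= => /andP[].
Qed.

Lemma is_derive_powR_sqr (R : realType) (p a c x : R) : 0 < x ->
  is_derive x 1 (fun y => c * y `^ p + a * (y - 1) ^+ 2)
    (c * (p * x `^ (p - 1)) + a * (2 * (x - 1))).
Proof.
move=> x0; have dp := is_derive1_powR p x0.
apply: is_derive_eq; rewrite /GRing.scale/=; ring.
Qed.

Lemma is_derive_powR_lin (R : realType) (p a c x : R) : 0 < x ->
  is_derive x 1 (fun y => c * (p * y `^ (p - 1)) + a * (2 * (y - 1)))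
    (c * (p * ((p - 1) * x `^ (p - 2))) + a * 2).
Proof.
move=> x0; have dp := is_derive1_powR (p - 1) x0.
apply: is_derive_eq; rewrite /GRing.scale/= (_ : p - 1 - 1 = p - 2); ring.
Qed.

(** Adding [a (y - 1)^2] with [2 a = p (1 - p) m^(p - 2)], the largest value of [- (y^p)''] on [[m,
    +oo[], makes [y^p] convex there; the bound is its tangent inequality at 1. *)
Lemma powR_ge_quad (R : realType) (p m z : R) :
  0 < p -> p < 1 -> 0 < m -> m <= 1 -> m <= z ->
  1 + p * (z - 1) - z `^ p <= p * (1 - p) / 2 * m `^ (p - 2) * (z - 1) ^+ 2.
Proof.
move=> p0 p1 m0 m1 mz; pose q := p * (1 - p) / 2.
pose a := q * m `^ (p - 2).
have gtm x : x \in `[m, +oo[%R -> m <= x by rewrite in_itv/= andbT.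
have := @tangent_le R _ _ _ `[m, +oo[%R 1 z
  (fun x xI => is_derive_powR_sqr p a 1 (lt_le_trans m0 (gtm x xI)))
  (fun x xI => is_derive_powR_lin p a 1 (lt_le_trans m0 (gtm x xI))).
rewrite !in_itv/= m1 mz => /(_ _ isT isT); rewrite !powR1 => H.
suff /H : {in `[m, +oo[%R,
  forall x : R, 0 <= 1 * (p * ((p - 1) * x `^ (p - 2))) + a * 2}.
  by rewrite /a /q; lra.
move=> x /gtm mx; have x0 := lt_le_trans m0 mx.
suff : x `^ (p - 2) <= m `^ (p - 2).
  rewrite -subr_ge0 => h.
  have : 0 <= (p * (1 - p)) * (m `^ (p - 2) - x `^ (p - 2)).
    by rewrite mulr_ge0 // mulr_ge0 ?subr_ge0 // ltW.
  rewrite /a /q; lra.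
have e : p - 2 = - (2 - p) by ring.
rewrite e !powRN lef_pV2 ?posrE ?powR_gt0//.
by apply: ge0_ler_powR; rewrite ?nnegrE; lra.
Qed.

(** Mirror image of the previous bound: [- y^p] stays convex on []0, M]] after subtracting the
    quadratic with the least curvature, which is attained at [M]. *)
Lemma powR_le_quad (R : realType) (p M z : R) :
  0 < p -> p < 1 -> 1 <= M -> 0 <= z -> z <= M ->
  p * (1 - p) / 2 * M `^ (p - 2) * (z - 1) ^+ 2 <= 1 + p * (z - 1) - z `^ p.
Proof.
move=> p0 p1 M1 + zM; pose q := p * (1 - p) / 2.
have M0 : 0 < M by apply: lt_le_trans M1.
(* The derivative formulas need a positive argument. At [z = 0] the claim is [q M^(p - 2) <= 1 - p],
   true because [M^(p - 2) <= 1] and [q = p (1 - p) / 2]. *)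
rewrite le_eqVlt => /predU1P[<-|z0].
  rewrite powR0 ?gt_eqF//.
  have : M `^ (p - 2) <= 1.
    rewrite -[leRHS](powRr0 M); apply: ler_powR => //; lra.
  have q0 : 0 < q by rewrite /q !mulr_gt0 // subr_gt0.
  rewrite -(ler_pM2l q0) /q; nra.
pose a := - (q * M `^ (p - 2)).
have I0 x : x \in `]0, M]%R -> 0 < x by rewrite in_itv/= => /andP[].
have := @tangent_le R _ _ _ `]0, M]%R 1 z
  (fun x xI => is_derive_powR_sqr p a (-1) (I0 x xI))
  (fun x xI => is_derive_powR_lin p a (-1) (I0 x xI)).
rewrite !in_itv/= M1 z0 zM ltr01 => /(_ _ isT isT); rewrite !powR1 => H.
suff /H : {in `]0, M]%R,
  forall x : R, 0 <= -1 * (p * ((p - 1) * x `^ (p - 2))) + a * 2}.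
  by rewrite /a /q; lra.
move=> x; rewrite in_itv/= => /andP[x0 xM].
suff : M `^ (p - 2) <= x `^ (p - 2).
  rewrite -subr_ge0 => h.
  have : 0 <= (p * (1 - p)) * (x `^ (p - 2) - M `^ (p - 2)).
    by rewrite mulr_ge0 // mulr_ge0 ?subr_ge0 // ltW.
  rewrite /a /q; lra.
have e : p - 2 = - (2 - p) by ring.
rewrite e !powRN lef_pV2 ?posrE ?powR_gt0//.
by apply: ge0_ler_powR; rewrite ?nnegrE; lra.
Qed.

(** Squeeze between the two quadratic bounds with [M] and [m] equal to [1 + |z n - 1|] and
    [1 - |z n - 1|]; both tend to 1, so both bounds have the same limit. *)
Lemma cvg_powR_quad (R : realType) (p : R) (z L : R^nat) (s : R) :
  0 < p -> p < 1 ->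
  (forall n, 0 <= L n) -> z @ \oo --> (1 : R) ->
  (fun n => L n * (z n - 1) ^+ 2) @ \oo --> s ->
  (fun n => L n * (1 + p * (z n - 1) - z n `^ p)) @ \oo --> p * (1 - p) / 2 * s.
Proof.
move=> p0 p1 L0 z1 Ls; pose q := p * (1 - p) / 2.
have d0 : (fun n => `|z n - 1|) @ \oo --> (0 : R).
  rewrite -(normr0 R) -(subrr 1); apply: cvg_norm; apply: cvgB => //.
  exact: cvg_cst.
have pw (c : R^nat) : c @ \oo --> (1 : R) ->
    (fun n => q * c n `^ (p - 2) * (L n * (z n - 1) ^+ 2)) @ \oo --> q * s.
  move=> c1; have -> : q * s = q * 1 `^ (p - 2) * s by rewrite powR1 mulr1.
  apply: cvgM => //; apply: cvgM; first exact: cvg_cst.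
  exact: cvg_powR.
apply: (@squeeze_cvgr _ _ _ _
  (fun n => q * (1 + `|z n - 1|) `^ (p - 2) * (L n * (z n - 1) ^+ 2))
  (fun n => q * (1 - `|z n - 1|) `^ (p - 2) * (L n * (z n - 1) ^+ 2))).
- near=> n.
  have dn : `|z n - 1| < 1.
    near: n; apply: (cvgr_lt 0) => //.
  have := ler_norm (z n - 1); have := ler_norm (- (z n - 1)); rewrite normrN.
  move=> h1 h2.
  rewrite ![_ * (L n * _)]mulrCA !(ler_wpM2l (L0 n))//.
    by apply: powR_ge_quad; lra.
  by apply: powR_le_quad; lra.
- apply: pw; rewrite -[X in _ --> X](addr0 1); apply: cvgD => //; exact: cvg_cst.
- apply: pw; rewrite -[X in _ --> X](subr0 1); apply: cvgB => //; exact: cvg_cst.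
Unshelve. all: by end_near. Qed.

(** * Sums as integrals of step functions *)

(** The interval [[k, k + 1[] seen in the variable [t] with [k = x + d t]. Being half-open, cells of
    different index are disjoint for [d > 0]. *)
Definition cell (R : realType) (x d : R) (k : nat) : set R :=
  `[(k%:R - x) / d, (k.+1%:R - x) / d[%classic.

Definition step_fun (R : realType) (x d : R) (n : nat) (c : R^nat) (t : R) : R :=
  \sum_(k < n.+1) c k * \1_(cell x d k) t.

Lemma mem_cell (R : realType) (x d t : R) (k : nat) : 0 < d ->
  (t \in cell x d k) = (k%:R <= x + d * t < k.+1%:R).
Proof.
move=> d0; rewrite mem_setE in_itv/= ler_pdivrMr// ltr_pdivlMr//.
by rewrite lerBlDl ltrBrDl mulrC.
Qed.

Lemma step_funE (R : realType) (x d t : R) (n k : nat) (c : R^nat) :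
  0 < d -> (k <= n)%N ->
  k%:R <= x + d * t < k.+1%:R -> step_fun x d n c t = c k.
Proof.
move=> d0 kn kt; have k0 : k%:R <= x + d * t by case/andP: kt.
rewrite /step_fun (bigD1 (Ordinal (kn : (k < n.+1)%N)))//=.
rewrite indicE mem_cell// kt mulr1.
rewrite big1 ?addr0// => i ik; rewrite indicE mem_cell//.
case: (boolP (i%:R <= x + d * t < i.+1%:R)) => [it|]; last by rewrite mulr0.
move: ik; rewrite -val_eqE/= => /eqP[].
by rewrite -(truncn_def it) (truncn_def kt).
Qed.

Lemma step_fun_bound (R : realType) (x d t g : R) (n : nat) (c : R^nat) :
  0 < d -> 0 <= g ->
  (forall k, (k <= n)%N -> k%:R <= x + d * t < k.+1%:R -> `|c k| <= g) ->
  `|step_fun x d n c t| <= g.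
Proof.
move=> d0 g0 cg; have [[k kt]|nk] :=
  pselect (exists k : 'I_n.+1, k%:R <= x + d * t < k.+1%:R).
  by rewrite (@step_funE _ _ _ _ _ k)// ?cg// -ltnS.
(* Where [t] lies in none of the cells the step function is 0, and the bound is [0 <= g]. *)
rewrite /step_fun big1 ?normr0// => i _; rewrite indicE mem_cell//.
case: (boolP (i%:R <= x + d * t < i.+1%:R)) => [it|]; last by rewrite mulr0.
by case: nk; exists i.
Qed.

Lemma integrable_cell (R : realType) (x d c : R) (k : nat) :
  (@lebesgue_measure R).-integrable setT
    (fun t => (c * \1_(cell x d k) t)%:E).
Proof.
under eq_fun do rewrite EFinM; apply: integrableZl => //.
exact: integrable_indic_itv.
Qed.

Lemma measurable_step_fun (R : realType) (x d : R) (n : nat) (c : R^nat) :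
  measurable_fun setT (step_fun x d n c).
Proof.
apply: measurable_sum => k; apply: measurable_funM => //.
by apply: measurable_indic; exact: measurable_itv.
Qed.

Lemma integral_step_fun (R : realType) (x d : R) (n : nat) (c : R^nat) : 0 < d ->
  (\int[@lebesgue_measure R]_t (step_fun x d n c t)%:E)%E =
  ((\sum_(k < n.+1) c k) / d)%:E.
Proof.
move=> d0; under eq_integral do rewrite -sumEFin.
rewrite integral_sum//; last by move=> k; exact: integrable_cell.
rewrite /= mulr_suml -sumEFin; apply: eq_bigr => k _.
under eq_integral do rewrite EFinM.
rewrite integralZl//; last exact: integrable_indic_itv.
rewrite integral_indic//= ?setIT; last exact: measurable_itv.
rewrite lebesgue_measure_itv/= lte_fin ltr_pM2r ?invr_gt0// ltrD2r ltr_nat ltnSn.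
by rewrite -EFinB -EFinM -mulrBl; congr (_ * _)%:E; rewrite -natr1; ring.
Qed.

(* The sum is the integral of a step function whose [k]-th cell has width
   [1 / d n], so dominated convergence applies. *)
Lemma cvg_sum_dominated (R : realType) (x d : R^nat) (c : nat -> R^nat)
    (f g : R -> R) (mu := @lebesgue_measure R) :
  (forall n, 0 < d n) -> mu.-integrable setT (EFin \o g) ->
  measurable_fun setT f ->
  (forall n k t, (k <= n)%N -> k%:R <= x n + d n * t < k.+1%:R ->
    `|c n k| <= g t) ->
  (forall t, 0 <= g t) ->
  (forall t, (fun n => step_fun (x n) (d n) n (c n) t) @ \oo --> f t) ->
  (fun n => (\sum_(k < n.+1) c n k) / d n) @ \oo --> \int[mu]_t f t.
Proof.
move=> d0 ig mf cg g0 cf.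
have [|||||+ _ +] := @dominated_convergence _ _ _ mu setT measurableT
  (fun n t => (step_fun (x n) (d n) n (c n) t)%:E) (EFin \o f) (EFin \o g).
- by move=> n; apply/measurable_EFinP; exact: measurable_step_fun.
- exact/measurable_EFinP.
- by apply: aeW => t _; apply: cvg_EFin; [exact: nearW|exact: cf].
- exact: ig.
- apply: aeW => t n _ /=; rewrite lee_fin; apply: step_fun_bound => // k kn.
  exact: cg.
move=> intf; have := integrable_fin_num measurableT intf => /=.
rewrite /Rintegral => fin; rewrite -(fineK fin).
under eq_cvg do rewrite integral_step_fun//.
by move/fine_cvgP => [].
Qed.

(** * Gaussian integrals *)

(** Matching [k = 1 / (2 sigma^2)] reduces integrability and the value of the integral to the normal
    density, whose total mass is 1. *)
Lemma gauss_normal_pdfE (R : realType) (k t : R) : 0 < k ->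
  expR (- k * t ^+ 2) = Num.sqrt (pi / k) * normal_pdf 0 (Num.sqrt (2 * k)^-1) t.
Proof.
move=> k0; have s2 : Num.sqrt (2 * k)^-1 ^+ 2 *+ 2 = k^-1.
  by rewrite sqr_sqrtr ?invr_ge0 ?mulr_ge0 ?(ltW k0)//; field; rewrite gt_eqF.
have s0 : Num.sqrt (2 * k)^-1 != 0.
  by rewrite gt_eqF// sqrtr_gt0 invr_gt0 mulr_gt0.
rewrite normal_pdfE// /normal_peak /normal_fun.
rewrite -mulrnAl s2 subr0 invrK [k^-1 * _]mulrC [RHS]mulrA divff ?mul1r.
  by congr expR; ring.
by rewrite gt_eqF// sqrtr_gt0 divr_gt0 ?pi_gt0.
Qed.

Lemma integrable_gauss (R : realType) (k : R) : 0 < k ->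
  (@lebesgue_measure R).-integrable setT (fun t => (expR (- k * t ^+ 2))%:E).
Proof.
move=> k0; under eq_fun do rewrite gauss_normal_pdfE// EFinM.
by apply: integrableZl => //; exact: integrable_normal_pdf.
Qed.

Lemma Rintegral_gauss (R : realType) (k : R) : 0 < k ->
  \int[@lebesgue_measure R]_t expR (- k * t ^+ 2) = Num.sqrt (pi / k).
Proof.
move=> k0; rewrite /Rintegral.
under eq_integral do rewrite gauss_normal_pdfE// EFinM.
rewrite integralZl//; last exact: integrable_normal_pdf.
by rewrite integral_normal_pdf mule1.
Qed.

(** * Gaussian domination of the summands *)

(** A single term of the exponential series suffices: for [p j >= a],
    [y^a <= (y^p)^j <= j! / c^j * exp (c y^p)]. *)
Lemma powR_le_expR (R : realType) (a c p : R) : 0 < c -> 0 < p ->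
  exists2 C, 0 <= C & forall y, 1 <= y -> y `^ a <= C * expR (c * y `^ p).
Proof.
move=> c0 p0; pose j := (Num.truncn (`|a| / p)).+1.
have aj : a <= p * j%:R.
  rewrite (le_trans (ler_norm a))// mulrC -ler_pdivrMr//.
  by rewrite ltW// truncnS_gt.
exists (j`!%:R / c ^+ j) => [|y y1].
  by rewrite divr_ge0// exprn_ge0// ltW.
have y0 : 0 <= y by apply: le_trans y1.
apply: (@le_trans _ _ ((y `^ p) ^+ j)).
  by rewrite -powR_mulrn ?powR_ge0// -powRrM ler_powR.
rewrite mulrAC ler_pdivlMr ?exprn_gt0// -exprMn mulrC.
have := @expR_ge1Dxn R (c * y `^ p) (Num.truncn (`|a| / p)).
rewrite mulr_ge0 ?powR_ge0 ?(ltW c0)// => /(_ isT); rewrite -/j => h.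
rewrite -ler_pdivrMl ?ltr0n ?fact_gt0// [leLHS]mulrC.
by apply: le_trans h; rewrite lerDr.
Qed.

Lemma powR_le_abs (R : realType) (a x K : R) : 1 <= K -> K^-1 <= x -> x <= K ->
  x `^ a <= K `^ `|a|.
Proof.
move=> K1 Kx xK; have K0 : 0 < K by apply: lt_le_trans K1.
have x0 : 0 < x by apply: lt_le_trans Kx; rewrite invr_gt0.
have [a0|a0] := leP 0 a.
  by rewrite ger0_norm// ge0_ler_powR ?nnegrE ?(ltW x0) ?(ltW K0).
have -> : x `^ a = x^-1 `^ (- a).
  by rewrite -powR_inv1 ?(ltW x0)// -powRrM mulN1r opprK.
rewrite ltr0_norm// ge0_ler_powR ?nnegrE ?invr_ge0 ?oppr_ge0
  ?(ltW x0) ?(ltW K0) ?(ltW a0)//.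
by rewrite invf_ple.
Qed.

(** For [x >= N / 2] the ratio stays between [(2 K)^-1] and [2 K]. For smaller [x] it may be as
    small as [1 / (N + 1)], but then the exponent on the right is of order [N^p] and absorbs the
    power [(N + 1)^|a|]. *)
Lemma powR_ratio_le_expR (R : realType) (a c p K : R) :
  0 < c -> 0 < p -> p < 1 -> 1 <= K ->
  exists2 C, 0 <= C & forall x N, 0 <= N -> 0 <= x -> x <= K * N ->
    ((x + 1) / (N + 1)) `^ a <=
    C * expR (c * ((x - N) ^+ 2 / (N + 1) `^ (2 - p))).
Proof.
move=> c0 p0 p1 K1.
have c8 : 0 < c / 8 by rewrite divr_gt0.
have [C1 C10 HC1] := @powR_le_expR R `|a| (c / 8) p c8 p0.
exists ((2 * K) `^ `|a| + C1 * expR (c / 4)) => [|x N N0 x0 xKN].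
  by rewrite addr_ge0 ?powR_ge0// mulr_ge0// expR_ge0.
have y0 : 0 < N + 1 by lra.
have s0 : 0 <= c * ((x - N) ^+ 2 / (N + 1) `^ (2 - p)).
  by rewrite mulr_ge0 ?(ltW c0)// divr_ge0 ?sqr_ge0// powR_ge0.
rewrite [leRHS]mulrDl; have [xN|xN] := leP (N / 2) x.
  rewrite -[leLHS]addr0; apply: lerD; last first.
    by rewrite !mulr_ge0// expR_ge0.
  rewrite -[leLHS]mulr1; apply: ler_pM; rewrite ?powR_ge0//.
    apply: powR_le_abs; first lra.
      rewrite ler_pdivlMr// ler_pdivrMl; last lra.
      by nra.
    by rewrite ler_pdivrMr//; nra.
  by rewrite -[leLHS]expR0 ler_expR.
rewrite -[leLHS]add0r; apply: lerD; first by rewrite mulr_ge0 ?powR_ge0 ?expR_ge0.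
apply: (@le_trans _ _ ((N + 1) `^ `|a|)).
  apply: powR_le_abs; first lra.
    by rewrite ler_pdivlMr// mulVf ?gt_eqF//; lra.
  by rewrite ler_pdivrMr//; nra.
apply: le_trans (HC1 _ _) _; first lra.
rewrite -[leRHS]mulrA ler_wpM2l// -expRD ler_expR.
have d0 : 1 <= (N + 1) `^ (2 - p).
  by rewrite -[leLHS](powRr0 (N + 1)) ler_powR; lra.
have -> : (N + 1) `^ p = (N + 1) ^+ 2 / (N + 1) `^ (2 - p).
  rewrite -powR_mulrn ?(ltW y0)// -powRB ?(gt_eqF y0) ?implybT//.
  by congr powR; ring.
set D := (N + 1) `^ (2 - p) in d0 *.
have D0 : 0 < D by lra.
(* With the rate [c / 8] and the spare factor [expR (c / 4)] the claim becomes
   [(N + 1)^2 <= 2 D + 8 (x - N)^2]. It follows from [D >= 1], [8 (x - N)^2 >= 2 N^2] and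
   [2 N^2 + 2 >= (N + 1)^2]. *)
rewrite -subr_ge0 (_ : _ - _ =
  c * (2 * D + (8 * (x - N) ^+ 2 - (N + 1) ^+ 2)) / (8 * D)); last first.
  by field; rewrite gt_eqF.
apply: divr_ge0; last lra.
apply: mulr_ge0; first exact: ltW.
have h1 : 0 <= (N / 2 - x) * (3 * N / 2 - x) by apply: mulr_ge0; lra.
have := sqr_ge0 (N - 1); lra.
Qed.

(** After division by [N] the constraint reads [X + m Y = m + 1], so the linear terms of the
    expansions at 1 cancel. The defect of [X] gives the decay, with [m + 1] as upper bound for [X];
    the defect of [Y] has the right sign and is dropped. *)
Lemma phase_le (R : realType) (p m x y N : R) :
  0 < p -> p < 1 -> 1 <= m -> 0 <= x -> 0 <= y -> 0 <= N ->
  x + m * y = (m + 1) * N ->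
  x `^ p + m * y `^ p - (m + 1) * N `^ p <=
  - (p * (1 - p) / 2 * (m + 1) `^ (p - 2)) * ((x - N) ^+ 2 / (N + 1) `^ (2 - p)).
Proof.
move=> p0 p1 m1 x0 y0 N0 xyN; have p_neq0 : p != 0 by rewrite gt_eqF.
have [NE|N_neq0] := eqVneq N 0.
  have [-> ->] : x = 0 /\ y = 0 by rewrite NE in xyN; nra.
  by rewrite NE powR0// subr0 expr0n/= mul0r !mulr0 addr0 subr0.
have N_gt0 : 0 < N by rewrite lt_neqAle eq_sym N_neq0.
have [X xE] : exists X, x = N * X by exists (x / N); rewrite mulrC divfK.
have [Y yE] : exists Y, y = N * Y by exists (y / N); rewrite mulrC divfK.
have X0 : 0 <= X by rewrite -(pmulr_rge0 _ N_gt0) -xE.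
have Y0 : 0 <= Y by rewrite -(pmulr_rge0 _ N_gt0) -yE.
have XY : X + m * Y = m + 1.
  by apply: (mulfI N_neq0); rewrite mulrDr mulrCA -xE -yE xyN mulrC.
have X1 : X <= m + 1 by nra.
have Y1 : Y <= m + 1 by nra.
rewrite xE yE !powRM ?(ltW N_gt0)//.
have M1 : 1 <= m + 1 by lra.
have hX := @powR_le_quad R p (m + 1) X p0 p1 M1 X0 X1.
have hY := @powR_le_quad R p (m + 1) Y p0 p1 M1 Y0 Y1.
have q0 : 0 <= p * (1 - p) / 2 * (m + 1) `^ (p - 2).
  by rewrite !mulr_ge0 ?invr_ge0 ?powR_ge0 ?(ltW p0) ?subr_ge0 ?(ltW p1).
have hY0 : 0 <= 1 + p * (Y - 1) - Y `^ p.
  by apply: le_trans hY; apply: mulr_ge0 => //; exact: sqr_ge0.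
set q := p * (1 - p) / 2 * (m + 1) `^ (p - 2) in hX q0 *.
have -> : N `^ p * X `^ p + m * (N `^ p * Y `^ p) - (m + 1) * N `^ p =
  - (N `^ p * ((1 + p * (X - 1) - X `^ p) + m * (1 + p * (Y - 1) - Y `^ p))
    - p * N `^ p * (X + m * Y - (m + 1))) by ring.
rewrite XY subrr mulr0 subr0 mulNr lerN2.
apply: (@le_trans _ _ (N `^ p * (q * (X - 1) ^+ 2))); last first.
  apply: ler_wpM2l; first exact: powR_ge0.
  nra.
have -> : (N * X - N) ^+ 2 = N `^ 2 * (X - 1) ^+ 2.
  by rewrite -[2]/(2%:R) powR_mulrn//; ring.
have -> : N `^ p = N `^ 2 / N `^ (2 - p).
  rewrite -powRB ?N_neq0 ?implybT//.
  by congr powR; ring.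
(* Putting [N + 1] for [N] in the denominator only weakens the decay. *)
rewrite [leLHS](_ : _ = N `^ 2 * q * (X - 1) ^+ 2 / (N + 1) `^ (2 - p));
  last ring.
rewrite [leRHS](_ : _ = N `^ 2 * q * (X - 1) ^+ 2 / N `^ (2 - p)); last ring.
apply: ler_wpM2l.
  by apply: mulr_ge0; [rewrite mulr_ge0 ?powR_ge0|exact: sqr_ge0].
rewrite lef_pV2 ?posrE ?powR_gt0//; last lra.
by apply: ge0_ler_powR; rewrite ?nnegrE; lra.
Qed.

(* [x + 1] instead of [x] keeps the function positive at [x = 0], where
   [0 `^ - e] is [0] for [e != 0]. *)
Definition stretched_exp (R : realType) (r p e x : R) : R :=
  expR (r * x `^ p) * (x + 1) `^ (- e).

(** The scale of the Gaussian peak. The shift by 1 keeps it at least 1 even at [x = 0] (for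
    [p < 1]), so that no cell is longer than 1. *)
Definition width (R : realType) (p x : R) : R := (x + 1) `^ (1 - p / 2).

Lemma stretched_exp_gt0 (R : realType) (r p e x : R) :
  0 <= x -> 0 < stretched_exp r p e x.
Proof. by move=> x0; rewrite mulr_gt0 ?expR_gt0 ?powR_gt0//; lra. Qed.

Lemma width_gt0 (R : realType) (p x : R) : 0 <= x -> 0 < width p x.
Proof. by move=> x0; rewrite powR_gt0//; lra. Qed.

Lemma width_ge1 (R : realType) (p x : R) : p < 1 -> 0 <= x -> 1 <= width p x.
Proof.
by move=> p1 x0; rewrite -[leLHS](powRr0 (x + 1)) ler_powR; lra.
Qed.

Lemma sqr_width (R : realType) (p x : R) : 0 <= x ->
  width p x ^+ 2 = (x + 1) `^ (2 - p).
Proof.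
move=> x0; rewrite -powR_mulrn ?powR_ge0// -powRrM; congr powR; lra.
Qed.

(** Separates the phase, which carries the Gaussian, from the power factors, which tend to 1 near
    the peak and are absorbed away from it. *)
Lemma stretched_exp_ratioE (R : realType) (r p m b e x y N : R) :
  0 <= x -> 0 <= y -> 0 <= N ->
  stretched_exp r p b x * stretched_exp (r * m) p e y /
    stretched_exp (r * (m + 1)) p (b + e) N =
  expR (r * (x `^ p + m * y `^ p - (m + 1) * N `^ p)) *
  (((x + 1) / (N + 1)) `^ (- b) * ((y + 1) / (N + 1)) `^ (- e)).
Proof.
move=> x0 y0 N0.
have N1 : 0 < N + 1 by lra.
have pw z a : 0 <= z -> ((z + 1) / (N + 1)) `^ a = (z + 1) `^ a / (N + 1) `^ a.
  move=> z0; rewrite powRM ?invr_ge0; try lra.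
  by rewrite -powRN -powR_inv1 ?(ltW N1)// -powRrM mulN1r.
rewrite /stretched_exp !pw//.
have -> : - (b + e) = - b + - e by ring.
rewrite powRD ?(gt_eqF N1) ?implybT//.
have -> : r * (x `^ p + m * y `^ p - (m + 1) * N `^ p) =
  r * x `^ p + r * m * y `^ p - r * (m + 1) * N `^ p by ring.
rewrite expRB expRD.
by field; rewrite !gt_eqF ?powR_gt0 ?expR_gt0.
Qed.

(** The phase yields the rate [c]; each of the two power factors costs [c / 4], which leaves
    [c / 2]. *)
Lemma stretched_exp_ratio_le (R : realType) (r p m b e : R) :
  0 < r -> 0 < p -> p < 1 -> 1 <= m ->
  exists c C, [/\ 0 < c, 0 <= C & forall x y N,
    0 <= x -> 0 <= y -> 0 <= N -> x + m * y = (m + 1) * N ->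
    stretched_exp r p b x * stretched_exp (r * m) p e y /
    stretched_exp (r * (m + 1)) p (b + e) N <=
    C * expR (- c * ((x - N) / width p N) ^+ 2)].
Proof.
move=> r0 p0 p1 m1.
pose c := r * (p * (1 - p) / 2 * (m + 1) `^ (p - 2)).
have c0 : 0 < c by rewrite !mulr_gt0 ?invr_gt0 ?powR_gt0 ?subr_gt0//; lra.
have c4 : 0 < c / 4 by rewrite divr_gt0.
have M1 : 1 <= m + 1 by lra.
have [Cb Cb0 HCb] := powR_ratio_le_expR (- b) c4 p0 p1 M1.
have [Ce Ce0 HCe] := powR_ratio_le_expR (- e) c4 p0 p1 M1.
exists (c / 2), (Cb * Ce); split; [by rewrite divr_gt0|exact: mulr_ge0|].
move=> x y N x0 y0 N0 xyN; rewrite stretched_exp_ratioE//.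
rewrite expr_div_n sqr_width//.
have D0 : 0 < (N + 1) `^ (2 - p) by rewrite powR_gt0; lra.
(* As [x, y >= 0] and [m >= 1], the constraint bounds both [x] and [y] by [(m + 1) N]. *)
have hx := HCb x N N0 x0 ltac:(nra).
have hy := HCe y N N0 y0 ltac:(nra).
have hE := phase_le p0 p1 m1 x0 y0 N0 xyN.
set S := (x - N) ^+ 2 / _ in hx hE *.
(* The constraint gives [x - N = - m (y - N)] with [m >= 1], so [y] is no further from [N] than
   [x]. *)
have yS : (y - N) ^+ 2 / (N + 1) `^ (2 - p) <= S.
  rewrite ler_pM2r ?invr_gt0//.
  have -> : x - N = - m * (y - N) by lra.
  have : 0 <= (m ^+ 2 - 1) * (y - N) ^+ 2.
    by apply: mulr_ge0; [nra|exact: sqr_ge0].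
  lra.
have {}hy := le_trans hy (ler_wpM2l Ce0 (_ : _ <= expR (c / 4 * S))).
have {hy}/hy hy :
    expR (c / 4 * ((y - N) ^+ 2 / (N + 1) `^ (2 - p))) <= expR (c / 4 * S).
  by rewrite ler_expR ler_wpM2l ?(ltW c4).
have -> : Cb * Ce * expR (- (c / 2) * S) =
  expR (- c * S) * ((Cb * expR (c / 4 * S)) * (Ce * expR (c / 4 * S))).
  have -> : - (c / 2) * S = - c * S + c / 4 * S + c / 4 * S by lra.
  by rewrite !expRD; ring.
apply: ler_pM; rewrite ?expR_ge0//.
- by rewrite mulr_ge0 ?powR_ge0.
- rewrite ler_expR (_ : - c * S =
    r * (- (p * (1 - p) / 2 * (m + 1) `^ (p - 2)) * S)).
    by rewrite ler_pM2l.
  by rewrite /c; ring.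
- by apply: ler_pM; rewrite ?powR_ge0.
Qed.

(** * Pointwise limit of the rescaled summands *)

Lemma cvg_powR_pinfty (R : realType) (u : R^nat) (a : R) : 0 < a ->
  u @ \oo --> +oo -> (fun n => u n `^ a) @ \oo --> +oo.
Proof.
move=> a0 /cvgryPge uoo; apply/cvgryPge => A; near=> n.
have un : `|A| `^ a^-1 <= u n by near: n; exact: uoo.
apply: (le_trans (ler_norm A)).
rewrite -[leLHS](@powRr1 _ `|A|)// -(@mulVf _ a) ?gt_eqF// powRrM.
apply: ge0_ler_powR => //; rewrite ?nnegrE ?powR_ge0 ?(ltW a0)//.
exact: le_trans (powR_ge0 _ _) un.
Unshelve. all: by end_near. Qed.

Lemma cvg_inv_pinfty (R : realType) (u : R^nat) :
  u @ \oo --> +oo -> (fun n => (u n)^-1) @ \oo --> (0 : R).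
Proof. by move=> uoo; apply/gtr0_cvgV0 => //; exact/(cvgryPgt _).1. Qed.

Lemma cvg_addr_pinfty (R : realType) (u : R^nat) (a : R) :
  u @ \oo --> +oo -> (fun n => u n + a) @ \oo --> +oo.
Proof.
move=> /cvgryPge uoo; apply/cvgryPge => A.
by near=> n; rewrite -lerBlDr; near: n; exact: uoo.
Unshelve. all: by end_near. Qed.

Lemma cvg_width_pinfty (R : realType) (p : R) (N : R^nat) : p < 1 ->
  N @ \oo --> +oo -> (fun n => width p (N n)) @ \oo --> +oo.
Proof.
move=> p1 Noo; apply: cvg_powR_pinfty; first lra.
exact: cvg_addr_pinfty.
Qed.

Lemma cvg_succ_ratio (R : realType) (N : R^nat) : N @ \oo --> +oo ->
  (fun n => (N n + 1) / N n) @ \oo --> (1 : R).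
Proof.
move=> Noo; have N0 := (cvgryPgt _).1 Noo 0.
have : (fun n => 1 + (N n)^-1) @ \oo --> (1 : R).
  rewrite -[X in _ --> X]addr0; apply: cvgD; first exact: cvg_cst.
  exact: cvg_inv_pinfty.
apply: cvg_trans; apply: near_eq_cvg; near=> n.
have Nn : 0 < N n by near: n; exact: N0.
by rewrite mulrDl divff ?gt_eqF// mul1r.
Unshelve. all: by end_near. Qed.

(** The quotient is [(N + 1)^(- p / 2)] times a factor tending to 1. Hence an index at a bounded
    number of widths from [N] is asymptotic to [N]. *)
Lemma cvg_width_ratio (R : realType) (p : R) (N : R^nat) : 0 < p ->
  N @ \oo --> +oo -> (fun n => width p (N n) / N n) @ \oo --> (0 : R).
Proof.
move=> p0 Noo; have N0 := (cvgryPgt _).1 Noo 0.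
have : (fun n => ((N n + 1) `^ (p / 2))^-1 * ((N n + 1) / N n)) @ \oo
    --> (0 * 1 : R).
  apply: cvgM; last exact: cvg_succ_ratio.
  apply: cvg_inv_pinfty; apply: cvg_powR_pinfty; first by rewrite divr_gt0.
  exact: cvg_addr_pinfty.
rewrite mul0r; apply: cvg_trans; apply: near_eq_cvg; near=> n.
have Nn : 0 < N n by near: n; exact: N0.
have N1 : 0 < N n + 1 by lra.
rewrite mulrA; congr (_ / _).
rewrite -powRN -[X in _ * X]powRr1 ?(ltW N1)// -powRD ?(gt_eqF N1) ?implybT//.
by congr powR; ring.
Unshelve. all: by end_near. Qed.

Lemma cvg_saddle_ratio (R : realType) (p t : R) (x N : R^nat) : 0 < p ->
  N @ \oo --> +oo ->
  (fun n => (x n - N n) / width p (N n)) @ \oo --> t ->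
  (fun n => x n / N n) @ \oo --> (1 : R).
Proof.
move=> p0 Noo st; have N0 := (cvgryPgt _).1 Noo 0.
have : (fun n => 1 + (x n - N n) / width p (N n) * (width p (N n) / N n)) @ \oo
    --> (1 + t * 0 : R).
  apply: cvgD; first exact: cvg_cst.
  by apply: cvgM => //; exact: cvg_width_ratio.
rewrite mulr0 addr0; apply: cvg_trans; apply: near_eq_cvg; near=> n.
have Nn : 0 < N n by near: n; exact: N0.
have wn : 0 < width p (N n) by rewrite width_gt0// ltW.
by field; rewrite !gt_eqF.
Unshelve. all: by end_near. Qed.

Lemma cvg_saddle_ratio1 (R : realType) (x N : R^nat) :
  N @ \oo --> +oo -> (fun n => x n / N n) @ \oo --> (1 : R) ->
  (fun n => (x n + 1) / (N n + 1)) @ \oo --> (1 : R).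
Proof.
move=> Noo z1; have N0 := (cvgryPgt _).1 Noo 0.
have : (fun n => (x n / N n + (N n)^-1) / ((N n + 1) / N n)) @ \oo
    --> ((1 + 0) / 1 : R).
  apply: cvgM.
    by apply: cvgD => //; exact: cvg_inv_pinfty.
  by apply: cvgV; [rewrite oner_eq0|exact: cvg_succ_ratio].
rewrite addr0 divr1; apply: cvg_trans; apply: near_eq_cvg; near=> n.
have Nn : 0 < N n by near: n; exact: N0.
by field; rewrite !gt_eqF//; lra.
Unshelve. all: by end_near. Qed.

Lemma cvg_saddle_pinfty (R : realType) (x N : R^nat) :
  N @ \oo --> +oo -> (fun n => x n / N n) @ \oo --> (1 : R) ->
  x @ \oo --> +oo.
Proof.
move=> Noo z1; apply/cvgryPge => A; near=> n.
have Nn : 0 < N n by near: n; exact: (cvgryPgt _).1 Noo 0.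
have NA : 2 * `|A| <= N n by near: n; exact: (cvgryPge _).1 Noo _.
have : 2^-1 < x n / N n by near: n; apply: (cvgr_gt 1) => //; lra.
rewrite ltr_pdivlMr//; have := ler_norm A; lra.
Unshelve. all: by end_near. Qed.

(** The linear terms cancel as in [phase_le]. With [q = p (1 - p) / 2] the quadratic ones contribute
    [q t^2] from [x] and [m q (t / m)^2] from the [m]-fold [y], hence the factor [1 + 1 / m]. *)
Lemma cvg_phase (R : realType) (p m t : R) (x y N : R^nat) :
  0 < p -> p < 1 -> 1 <= m -> N @ \oo --> +oo ->
  (forall n, x n + m * y n = (m + 1) * N n) ->
  (fun n => (x n - N n) / width p (N n)) @ \oo --> t ->
  (fun n => x n `^ p + m * y n `^ p - (m + 1) * N n `^ p) @ \oo -->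
  - (p * (1 - p) / 2 * (1 + m^-1) * t ^+ 2).
Proof.
move=> p0 p1 m1 Noo xyN st; have N0 := (cvgryPgt _).1 Noo 0.
have m0 : 0 < m by lra.
have zx := cvg_saddle_ratio p0 Noo st.
(* This is [y n / N n], solved from the constraint. *)
pose z' n := 1 - m^-1 * (x n / N n - 1).
have zy : z' @ \oo --> (1 : R).
  have : z' @ \oo --> (1 - m^-1 * (1 - 1) : R).
    apply: cvgB; first exact: cvg_cst.
    by apply: cvgM; [|apply: cvgB => //]; exact: cvg_cst.
  by rewrite subrr mulr0 subr0.
have L0 n : 0 <= N n `^ p by exact: powR_ge0.
(* Since [N^p = N^2 / N^(2 - p)] and the squared width is [(N + 1)^(2 - p)], this is the squared
   rescaled deviation up to a factor tending to 1. *)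
have Lx : (fun n => N n `^ p * (x n / N n - 1) ^+ 2) @ \oo --> t ^+ 2.
  have : (fun n => ((x n - N n) / width p (N n)) ^+ 2 *
      ((N n + 1) / N n) `^ (2 - p))
      @ \oo --> t ^+ 2 * 1 `^ (2 - p).
    apply: cvgM; last by apply: cvg_powR => //; exact: cvg_succ_ratio.
    by rewrite expr2; apply: cvgM.
  rewrite powR1 mulr1; apply: cvg_trans; apply: near_eq_cvg; near=> n.
  have Nn : 0 < N n by near: n; exact: N0.
  rewrite expr_div_n sqr_width ?(ltW Nn)// powRM ?invr_ge0 ?(ltW Nn)//; last lra.
  have -> : N n `^ p = N n ^+ 2 / N n `^ (2 - p).
    rewrite -powR_mulrn ?(ltW Nn)// -powRB ?(gt_eqF Nn) ?implybT//.
    by congr powR; ring.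
  have -> : (N n)^-1 `^ (2 - p) = (N n `^ (2 - p))^-1.
    by rewrite -powR_inv1 ?(ltW Nn)// -powRrM mulN1r powRN.
  by field; rewrite !gt_eqF ?powR_gt0//; lra.
have Ly : (fun n => N n `^ p * (z' n - 1) ^+ 2) @ \oo --> m^-1 ^+ 2 * t ^+ 2.
  have : (fun n => m^-1 ^+ 2 * (N n `^ p * (x n / N n - 1) ^+ 2)) @ \oo
      --> m^-1 ^+ 2 * t ^+ 2.
    by apply: cvgM => //; exact: cvg_cst.
  by apply: cvg_trans; apply: near_eq_cvg; apply: nearW => n; rewrite /z'; ring.
have Hx := cvg_powR_quad p0 p1 L0 zx Lx.
have Hy := cvg_powR_quad p0 p1 L0 zy Ly.
have -> : - (p * (1 - p) / 2 * (1 + m^-1) * t ^+ 2) =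
  - (p * (1 - p) / 2 * t ^+ 2 + m * (p * (1 - p) / 2 * (m^-1 ^+ 2 * t ^+ 2))).
  by field; rewrite gt_eqF.
have : (fun n => - (N n `^ p * (1 + p * (x n / N n - 1) - (x n / N n) `^ p) +
    m * (N n `^ p * (1 + p * (z' n - 1) - z' n `^ p)))) @ \oo -->
    - (p * (1 - p) / 2 * t ^+ 2 + m * (p * (1 - p) / 2 * (m^-1 ^+ 2 * t ^+ 2))).
  by apply: cvgN; apply: cvgD => //; apply: cvgM => //; exact: cvg_cst.
apply: cvg_trans; apply: near_eq_cvg; near=> n.
have Nn : 0 < N n by near: n; exact: N0.
(* Splitting [(N z)^p] needs nonnegative factors; the two ratios are positive eventually because
   they tend to 1. *)
have z0 : 0 < x n / N n by near: n; exact: (cvgr_gt 1).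
have z'0 : 0 < z' n by near: n; exact: (cvgr_gt 1).
have xE : x n = N n * (x n / N n) by rewrite mulrC divfK ?gt_eqF.
have yE : y n = N n * z' n.
  have -> : y n = ((m + 1) * N n - x n) / m.
    by rewrite -xyN addrAC subrr add0r mulrC mulKf ?gt_eqF.
  by rewrite /z'; field; rewrite !gt_eqF.
rewrite [in RHS]xE yE {xE yE}; move: z0 z'0; rewrite /z'.
set z := x n / N n => z0 z'0.
rewrite (powRM _ (ltW Nn) (ltW z0)) (powRM _ (ltW Nn) (ltW z'0)).
by field; rewrite !gt_eqF.
Unshelve. all: by end_near. Qed.

Lemma cvg_stretched_exp_ratio (R : realType) (r p m b e t : R) (x y N : R^nat) :
  0 < p -> p < 1 -> 1 <= m -> N @ \oo --> +oo ->
  (forall n, x n + m * y n = (m + 1) * N n) ->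
  (fun n => (x n - N n) / width p (N n)) @ \oo --> t ->
  [/\ x @ \oo --> +oo, y @ \oo --> +oo &
  (fun n => stretched_exp r p b (x n) * stretched_exp (r * m) p e (y n) /
            stretched_exp (r * (m + 1)) p (b + e) (N n)) @ \oo -->
  expR (- (r * (p * (1 - p) / 2) * (1 + m^-1)) * t ^+ 2)].
Proof.
move=> p0 p1 m1 Noo xyN st; have N0 := (cvgryPgt _).1 Noo 0.
have m0 : 0 < m by lra.
have zx := cvg_saddle_ratio p0 Noo st.
(* By the constraint [y] deviates from [N] by [- 1 / m] times the deviation of [x], so everything
   known about [x] applies to [y]. *)
have sty : (fun n => (y n - N n) / width p (N n)) @ \oo --> - m^-1 * t.
  have := cvgM (cvg_cst (- m^-1)) st => /(_ _ _).
  apply: cvg_trans; apply: near_eq_cvg; apply: nearW => n /=.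
  have -> : x n = (m + 1) * N n - m * y n by rewrite -xyN addrK.
  rewrite mulrA; congr (_ / _); field; rewrite gt_eqF//.
have zy := cvg_saddle_ratio p0 Noo sty.
have xoo := cvg_saddle_pinfty Noo zx.
have yoo := cvg_saddle_pinfty Noo zy.
split=> //.
have ph := cvg_phase p0 p1 m1 Noo xyN st.
have zx1 := @cvg_powR R _ (- b) _ ltr01 (cvg_saddle_ratio1 Noo zx).
have zy1 := @cvg_powR R _ (- e) _ ltr01 (cvg_saddle_ratio1 Noo zy).
have ex : (fun n => expR (r * (x n `^ p + m * y n `^ p - (m + 1) * N n `^ p)))
    @ \oo --> expR (r * - (p * (1 - p) / 2 * (1 + m^-1) * t ^+ 2)).
  apply: continuous_cvg; first exact: continuous_expR.
  by apply: cvgM => //; exact: cvg_cst.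
have := cvgM ex (cvgM zx1 zy1) => /(_ _ _); rewrite !powR1 !mulr1.
have -> : r * - (p * (1 - p) / 2 * (1 + m^-1) * t ^+ 2) =
  - (r * (p * (1 - p) / 2) * (1 + m^-1)) * t ^+ 2 by ring.
apply: cvg_trans; apply: near_eq_cvg; near=> n.
rewrite stretched_exp_ratioE//.
- by near: n; exact: (cvgryPge _).1 xoo 0.
- by near: n; exact: (cvgryPge _).1 yoo 0.
- by near: n; exact: (cvgryPge _).1 Noo 0.
Unshelve. all: by end_near. Qed.

(** * Asymptotics of one Cauchy product *)

Lemma cvg_mulr_pinfty (R : realType) (u : R^nat) (a : R) : 0 < a ->
  u @ \oo --> +oo -> (fun n => u n * a) @ \oo --> +oo.
Proof.
move=> a0 /cvgryPge uoo; apply/cvgryPge => A.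
by near=> n; rewrite -ler_pdivrMr//; near: n; exact: uoo.
Unshelve. all: by end_near. Qed.

(** The bound must hold at every index, not just eventually: small [k] and small [n - k] occur in
    every Cauchy product. *)
Lemma cvg_div_bound (R : realType) (f g : R^nat) (l : R) :
  (forall n, 0 < g n) -> (fun n => f n / g n) @ \oo --> l ->
  exists2 C, 0 <= C & forall n, `|f n| <= C * g n.
Proof.
move=> g0 fg; have [M [_ HM]] := cvg_seq_bounded (cvgP _ fg).
exists (`|M| + 1) => [|n]; first by rewrite addr_ge0.
rewrite -ler_pdivrMr// -[g n](ger0_norm (ltW (g0 n))) -normf_div.
have MM : M < `|M| + 1 by rewrite (le_lt_trans (ler_norm M))// ltrDl.
exact: (HM _ MM n I).
Qed.

(** The sum is about the peak value at [k = n / (m + 1)] times the width times a Gaussian integral.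
    The width lowers the exponent by [1 - p / 2], the integral gives the square root. *)
Lemma cvg_series_mul (R : realType) (r p b e A B : R) (m : nat) (w u : R^nat) :
  0 < r -> 0 < p -> p < 1 -> (0 < m)%N ->
  (fun n => w n / stretched_exp r p b n%:R) @ \oo --> B ->
  (fun n => u n / stretched_exp (r * m%:R) p e (n%:R / m%:R)) @ \oo --> A ->
  (fun n => series_mul w u n /
     stretched_exp (r * m.+1%:R) p (b + e - (1 - p / 2)) (n%:R / m.+1%:R))
     @ \oo -->
  B * A * Num.sqrt (pi / (r * (p * (1 - p) / 2) * (1 + m%:R^-1))).
Proof.
move=> r0 p0 p1 m0 wB uA.
have m0R : 0 < m%:R :> R by rewrite ltr0n.
have m1 : 1 <= m%:R :> R by rewrite ler1n.
rewrite -natr1.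
pose N n : R := n%:R / (m%:R + 1).
have N0 n : 0 <= N n by rewrite divr_ge0// addr_ge0.
have Noo : N @ \oo --> +oo.
  by apply: cvg_mulr_pinfty; [rewrite invr_gt0; lra|exact: cvgr_idn].
(* Subtraction in [R], so that the constraint holds for [k > n] as well. *)
pose y n k : R := (n%:R - k%:R) / m%:R.
have xyN n k : k%:R + m%:R * y n k = (m%:R + 1) * N n.
  by rewrite /y /N; field; rewrite !gt_eqF//; lra.
have d1 n : 1 <= width p (N n) by exact: width_ge1.
have d0 n : 0 < width p (N n) by exact: width_gt0.
pose M n := stretched_exp (r * (m%:R + 1)) p (b + e) (N n).
have M0 n : 0 < M n by exact: stretched_exp_gt0.
pose c n k := w k * u (n - k)%N / M n.
pose kap := r * (p * (1 - p) / 2) * (1 + m%:R^-1).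
have kap0 : 0 < kap.
  by rewrite !mulr_gt0 ?invr_gt0 ?subr_gt0// addr_gt0 ?invr_gt0.
have [Cw Cw0 HCw] :=
  cvg_div_bound (fun n => stretched_exp_gt0 r p b (ler0n _ n)) wB.
have nm0 n : 0 <= n%:R / m%:R :> R by rewrite divr_ge0.
have [Cu Cu0 HCu] :=
  cvg_div_bound (fun n => stretched_exp_gt0 (r * m%:R) p e (nm0 n)) uA.
have [q [C [q0 C0 HC]]] := stretched_exp_ratio_le b e r0 p0 p1 m1.
have yE n k : (k <= n)%N -> y n k = (n - k)%:R / m%:R.
  by move=> kn; rewrite /y natrB.
have c_le n k : (k <= n)%N ->
    `|c n k| <= Cw * Cu * C * expR (- q * ((k%:R - N n) / width p (N n)) ^+ 2).
  move=> kn; have := HC _ _ _ (ler0n _ k) (nm0 (n - k)%N) (N0 n).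
  rewrite -yE// xyN => /(_ erefl) h.
  rewrite /c normf_div normrM (gtr0_norm (M0 n)) -mulrA.
  apply: le_trans (ler_wpM2l (mulr_ge0 Cw0 Cu0) h).
  rewrite [leRHS]mulrA ler_pM2r ?invr_gt0//.
  apply: le_trans (ler_pM (normr_ge0 _) (normr_ge0 _) (HCw k) (HCu _)) _.
  by rewrite yE// mulrACA.
pose f t := B * A * expR (- kap * t ^+ 2).
(* On the cell of [k] the left end [s] satisfies [s <= t <= s + 1], whence [s^2 >= t^2 / 2 - 1]:
   this costs the factor [expR q] and half of the rate. *)
pose g t := Cw * Cu * C * expR q * expR (- (q / 2) * t ^+ 2).
have q20 : 0 < q / 2 by rewrite divr_gt0.
have -> : B * A * Num.sqrt (pi / kap) = \int[@lebesgue_measure R]_t f t.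
  by rewrite RintegralZl ?Rintegral_gauss//; exact: integrable_gauss.
have : (fun n => (\sum_(k < n.+1) c n k) / width p (N n)) @ \oo -->
    \int[@lebesgue_measure R]_t f t.
  apply: (@cvg_sum_dominated _ N _ c f g) => //.
  - rewrite (_ : EFin \o g = fun t => ((Cw * Cu * C * expR q)%:E *
        (expR (- (q / 2) * t ^+ 2))%:E)%E) //.
    by apply: integrableZl => //; exact: integrable_gauss.
  - apply: measurable_funM => //.
    by have /measurable_int/measurable_EFinP := integrable_gauss kap0.
  - move=> n k t kn /andP[kt tk]; apply: le_trans (c_le _ _ kn) _.
    rewrite -[leRHS]mulrA -expRD; apply: ler_wpM2l; first by rewrite !mulr_ge0.
    rewrite ler_expR; set s := (_ - _) / _.
    have st : s <= t by rewrite ler_pdivrMr// lerBlDl mulrC.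
    have ts : t <= s + 1.
      have : t <= s + 1 / width p (N n).
        rewrite /s -mulrDl ler_pdivlMr//; move: tk; rewrite -natr1; lra.
      move=> /le_trans; apply; rewrite lerD2l ler_pdivrMr // mul1r; exact: d1.
    have h1 : 0 <= q * ((2 * s - t) ^+ 2 + 2 * ((1 + s - t) * (1 - s + t))).
      apply: mulr_ge0; first exact: ltW.
      apply: addr_ge0; first exact: sqr_ge0.
      by apply: mulr_ge0 => //; apply: mulr_ge0; lra.
    lra.
  - by move=> t; rewrite !mulr_ge0 ?expR_ge0.
  move=> t.
  (* The index of the cell containing [t]. Truncation is the integer part only for nonnegative
     arguments, which [pos] secures for large [n]. *)
  pose K n := Num.truncn (N n + width p (N n) * t).
  have pos : \forall n \near \oo, 0 <= N n + width p (N n) * t.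
    have : (fun n => 1 + width p (N n) / N n * t) @ \oo --> (1 + 0 * t : R).
      apply: cvgD; first exact: cvg_cst.
      by apply: cvgM; [exact: cvg_width_ratio|exact: cvg_cst].
    rewrite mul0r addr0 => h; near=> n.
    have Nn : 0 < N n by near: n; exact: (cvgryPgt _).1 Noo 0.
    have : 0 < 1 + width p (N n) / N n * t.
      by near: n; exact: (cvgr_gt 1) h _ ltr01.
    rewrite -(pmulr_rgt0 _ Nn) => /ltW; congr (0 <= _).
    by field; rewrite gt_eqF.
  have st : (fun n => ((K n)%:R - N n) / width p (N n)) @ \oo --> t.
    apply: (@squeeze_cvgr _ _ _ _ (fun n => t - (width p (N n))^-1) (fun=> t)).
    - near=> n; have pn : 0 <= N n + width p (N n) * t by near: n.
      have /andP[h1 h2] := truncn_itv pn.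
      rewrite -/(K n) -natr1 in h1 h2.
      rewrite ler_pdivlMr// ler_pdivrMr// mulrBl mulVf ?gt_eqF//; lra.
    - rewrite -[X in _ --> X]subr0; apply: cvgB; first exact: cvg_cst.
      by apply: cvg_inv_pinfty; exact: cvg_width_pinfty.
    - exact: cvg_cst.
  have [Koo yoo ratio] := @cvg_stretched_exp_ratio R r p m%:R b e t
    (fun n => (K n)%:R) (fun n => y n (K n)) N p0 p1 m1 Noo
    (fun n => xyN n (K n)) st.
  (* The cell of [t] is eventually among those summed, because [y n (K n)] tends to infinity. *)
  have Kn : \forall n \near \oo, (K n <= n)%N.
    near=> n; have : 0 <= y n (K n) by near: n; exact: (cvgryPge _).1 yoo 0.
    by rewrite pmulr_lge0 ?invr_gt0// subr_ge0 ler_nat.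
  have nKoo : (fun n => n - K n)%N @ \oo --> \oo.
    apply/(@cvgrnyP R).
    have : (fun n => y n (K n) * m%:R) @ \oo --> +oo by exact: cvg_mulr_pinfty.
    apply: cvg_trans; apply: near_eq_cvg; near=> n.
    by rewrite natrB ?divfK ?gt_eqF//; near: n.
  have wK : (fun n => w (K n) / stretched_exp r p b (K n)%:R) @ \oo --> B.
    have KK : K @ \oo --> \oo by apply/(@cvgrnyP R).
    exact: (cvg_comp _ _ KK wB).
  have uK : (fun n => u (n - K n)%N /
      stretched_exp (r * m%:R) p e ((n - K n)%:R / m%:R)) @ \oo --> A.
    exact: (cvg_comp _ _ nKoo uA).
  have := cvgM (cvgM wK uK) ratio => /(_ _ _).
  apply: cvg_trans; apply: near_eq_cvg; near=> n.
  have pn : 0 <= N n + width p (N n) * t by near: n.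
  have kn : (K n <= n)%N by near: n.
  rewrite (@step_funE _ _ _ _ _ (K n))//; last exact: truncn_itv.
  rewrite /c /M /= -yE//.
  have y0 : 0 <= y n (K n) by rewrite yE.
  by field; rewrite !gt_eqF ?stretched_exp_gt0.
apply: cvg_trans; apply: near_eq_cvg; apply: nearW => n.
rewrite -mulr_suml -mulrA -invfM; congr (_ / _).
have N1 : 0 < N n + 1 by rewrite ltr_wpDl.
(* The width is a power of [N + 1] and merges with the one in the comparison function. *)
rewrite /M /stretched_exp /width -[LHS]mulrA -powRD ?(gt_eqF N1) ?implybT//.
by congr (_ * powR _ _); ring.
Unshelve. all: by end_near. Qed.

(** * Induction on the power *)

Lemma series_exp1 (R : realType) (u : R^nat) : series_exp u 1 = u.
Proof.
apply/funext => n; rewrite /series_exp /= /series_mul big_ord_recr/= subnn.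
rewrite /series_one eqxx mulr1 big1 ?add0r// => k _.
by rewrite subn_eq0 leqNgt ltn_ord mulr0.
Qed.

(** With [G = 2 pi / ((1 - p) p r)], passing from the power [m] to [m + 1] contributes the factor
    [sqrt (G m / (m + 1))]. The quotients telescope to [h.+1^(- 1/2)], and [G] accumulates to
    [G^(h / 2)]. *)
Lemma cvg_series_exp (R : realType) (r p b v : R) (beta : R^nat) (h : nat) :
  0 < r -> 0 < p -> p < 1 ->
  (fun n => beta n / stretched_exp r p b n%:R) @ \oo --> v ->
  (fun n => series_exp beta h.+1 n / stretched_exp (r * h.+1%:R) p
     (b * h.+1%:R - h%:R * (1 - p / 2)) (n%:R / h.+1%:R)) @ \oo -->
  v ^+ h.+1 * (h.+1%:R `^ (- 2^-1) * (2 * pi / ((1 - p) * p * r)) `^ (h%:R / 2)).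
Proof.
move=> r0 p0 p1 bv; elim: h => [|h IH].
  rewrite series_exp1 expr1 !mulr1 !mul0r subr0 powRr0 powR1 !mulr1.
  by under eq_fun do rewrite divr1.
have := cvg_series_mul r0 p0 p1 (ltn0Sn h) bv IH.
set l := (X in _ --> X); set l' := (X in _ -> _ --> X).
have -> : l = l'.
  rewrite /l /l'.
  have H0 : 0 < h.+1%:R :> R by rewrite ltr0n.
  have H1 : 0 < h.+2%:R :> R by rewrite ltr0n.
  have pi0 := pi_gt0 R.
  set G := 2 * pi / ((1 - p) * p * r).
  have G0 : 0 < G by rewrite !(mulr_gt0, invr_gt0) ?subr_gt0.
  have -> : pi / (r * (p * (1 - p) / 2) * (1 + h.+1%:R^-1)) =
      G * h.+1%:R * h.+2%:R^-1.
    by rewrite /G -[h.+2%:R]natr1; field; rewrite !gt_eqF ?subr_gt0//; lra.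
  clearbody G.
  have -> : h.+1%:R / 2 = h%:R / 2 + 2^-1 :> R by rewrite -natr1; field.
  rewrite powRD ?(gt_eqF G0) ?implybT// [v ^+ h.+2]exprS.
  rewrite -powR12_sqrt ?(mulr_ge0, invr_ge0) ?(ltW G0) ?ler0n//.
  rewrite !powRM ?(mulr_ge0, invr_ge0) ?(ltW G0) ?ler0n//.
  rewrite -[h.+2%:R^-1]powR_inv1 ?ler0n// -powRrM mulN1r !powRN.
  by field; rewrite !gt_eqF// powR_gt0.
apply: cvg_trans; apply: near_eq_cvg; apply: nearW => n.
rewrite /series_exp iterS; congr (_ / stretched_exp _ _ _ _).
by rewrite -[in LHS]natr1; field.
Qed.

(** * Return from shifted comparison functions to powers of [n] *)

Theorem theorem2 (R : realType) (h : nat) (r p v b : R) (beta a : R^nat) :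
  (1 <= h)%N -> 0 < r -> 0 < p -> p < 1 -> v != 0 ->
  asymp_equiv beta
    (fun n : nat => v * (expR (r * n%:R `^ p) / n%:R `^ b)) ->
  a = series_exp beta h ->
  asymp_equiv a
    (fun n : nat =>
       v ^+ h
       * h%:R `^ (b * h%:R + h%:R * p / 2 - h%:R - p / 2 + 1 / 2)
       * (2 * pi / ((1 - p) * p * r)) `^ ((h%:R - 1) / 2)
       * (expR (r * h%:R `^ (1 - p) * n%:R `^ p)
          / n%:R `^ (b * h%:R - 1 / 2 * (h%:R - 1) * (2 - p)))).
Proof.
case: h => // h _ r0 p0 p1 v0 betaE ->.
have noo := @cvgr_idn R.
(* Replacing [n^b] by [(n + 1)^b] costs the factor [((n + 1) / n)^b], which tends to 1. *)
have bv : (fun n => beta n / stretched_exp r p b n%:R) @ \oo --> v.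
  have := cvgM (cvgM betaE (cvg_cst v))
    (@cvg_powR R _ b _ ltr01 (cvg_succ_ratio noo)) => /(_ _ _ _).
  rewrite powR1 mulr1 mul1r; apply: cvg_trans; apply: near_eq_cvg; near=> n.
  have n0 : 0 < n%:R :> R by near: n; exact: (cvgryPgt _).1 noo 0.
  have n1 : 0 < n%:R + 1 :> R by lra.
  rewrite /stretched_exp powRN /= powRM ?invr_ge0 ?(ltW n0) ?(ltW n1)//.
  rewrite -[n%:R^-1]powR_inv1 ?(ltW n0)// -powRrM mulN1r powRN.
  by field; rewrite v0 !gt_eqF ?powR_gt0 ?expR_gt0.
have H0 : 0 < h.+1%:R :> R by rewrite ltr0n.
have G0 : 0 < 2 * pi / ((1 - p) * p * r).
  by rewrite !(mulr_gt0, invr_gt0) ?subr_gt0 ?pi_gt0.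
set e := b * h.+1%:R - h%:R * (1 - p / 2).
have xoo : (fun n => n%:R / h.+1%:R) @ \oo --> (+oo : set_system R).
  by apply: cvg_mulr_pinfty => //; rewrite invr_gt0.
set L := v ^+ h.+1 *
  (h.+1%:R `^ (- 2^-1) * (2 * pi / ((1 - p) * p * r)) `^ (h%:R / 2)).
have L0 : L != 0.
  by rewrite !mulf_neq0 ?expf_neq0// gt_eqF// powR_gt0.
(* The shift is undone at the argument [n / h.+1], and division by the nonzero constant [L] makes
   the limit 1. *)
have := cvgM (cvgM (@cvg_series_exp _ _ _ _ _ _ h r0 p0 p1 bv)
  (@cvg_powR R _ (- e) _ ltr01 (cvg_succ_ratio xoo)))
  (cvg_cst L^-1) => /(_ _ _ _).
rewrite -/L powR1 mulr1 divff//; apply: cvg_trans; apply: near_eq_cvg; near=> n.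
have n0 : 0 < n%:R :> R by near: n; exact: (cvgryPgt _).1 noo 0.
have hE : h.+1%:R - 1 = h%:R :> R by rewrite -natr1 addrK.
have -> : b * h.+1%:R - 1 / 2 * (h.+1%:R - 1) * (2 - p) = e.
  by rewrite /e hE; field.
(* The power of [h.+1] has two sources: [e] from [n^e = h.+1^e x^e], and [- 1/2] from the telescoped
   Gaussian constants. *)
have -> : b * h.+1%:R + h.+1%:R * p / 2 - h.+1%:R - p / 2 + 1 / 2 = e - 2^-1.
  by rewrite /e -natr1; field.
rewrite hE /=; set x : R := n%:R / h.+1%:R.
have x0 : 0 < x by rewrite divr_gt0.
have x1 : 0 < x + 1 by lra.
have -> : r * h.+1%:R `^ (1 - p) * n%:R `^ p = r * h.+1%:R * x `^ p.
  have -> : n%:R = h.+1%:R * x by rewrite /x mulrC divfK ?gt_eqF.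
  rewrite powRM ?(ltW H0) ?(ltW x0)// -!mulrA; congr (_ * _); rewrite mulrA.
  by rewrite -powRD ?(gt_eqF H0) ?implybT// subrK powRr1 ?(ltW H0).
have -> : n%:R `^ e = h.+1%:R `^ e * x `^ e.
  by rewrite -powRM ?(ltW H0) ?(ltW x0)// /x mulrC divfK ?gt_eqF.
rewrite /stretched_exp /L /= powRM ?invr_ge0 ?(ltW x1) ?(ltW x0)//.
rewrite -[x^-1]powR_inv1 ?(ltW x0)// -powRrM mulN1r opprK.
rewrite -/e (@powRB _ h.+1%:R e) ?(gt_eqF H0) ?implybT// !powRN.
by field; rewrite ?v0 ?expf_neq0 ?(negPf v0)// !gt_eqF ?powR_gt0 ?expR_gt0.
Unshelve. all: by end_near. Qed.
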